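(* Let $(G,\pi)$ be a parity game, $\tau$ a strategy for Odd, $T$ an ordered tree of height $d/2$, and $H:=G_\tau\setminus\bigcup_{v\in B(G_\tau)}\delta^+(v)$. Consider the procedure Dijkstra which, given $\nu:V\to\bar L(T)$: sets $S:=B(G_\tau)$ and $\nu(v):=\top$ for $v\notin S$; for every arc $vw\in E_\tau$ with $w\in S$, $v\notin S$, sets $\nu(v):=\mathrm{drop}(\nu,vw)$; then, while $S\ne V$, picks $u\in\arg\min_{v\in V\setminus S}\Phi^\nu(v)$ (ties broken arbitrarily), adds $u$ to $S$, and for every arc $vu\in E_\tau$ with $v\notin S$ sets $\nu(v):=\mathrm{drop}(\nu,vu)$; finally returns $\nu$. Then for any input $\nu$, Dijkstra returns the pointwise minimal node labeling $\nu^*:V\to\bar L(T)$ which is feasible in $H$ and satisfies $\nu^*(v)=\nu(v)$ for all $v\in B(G_\tau)$.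
   Context: A parity game: finite directed graph $G=(V,E)$, every node with an outgoing arc, $V=V_0\sqcup V_1$, priorities $\pi:V\to\{1,\dots,d\}$, $d$ even. A strategy for Odd is $\tau:V_1\to V$ with $v\tau(v)\in E$; $G_\tau=(V,E_\tau)$ with $E_\tau=\{vw\in E:v\in V_0\}\cup\{v\tau(v):v\in V_1\}$. An Even strategy $\sigma:V_0\to V$ gives $G_\sigma$ (all arcs out of $V_1$, only $v\sigma(v)$ out of $v\in V_0$). For a subgraph $K$: $\pi(K)$ max priority, $K$ even if $\pi(K)$ even, $\Pi(K)$ nodes of priority $\pi(K)$, $K_p$ induced subgraph on nodes of priority $\le p$, $\delta^+(v)$ outgoing arcs. Base nodes $B(G_\tau)$: nodes in $\Pi(C)$ for some even cycle $C$ of $G_\tau$. Ordered trees: prefix-closed sets of tuples over a linearly ordered set, viewed as rooted trees, ordered lexicographically; leaves of a height-$d/2$ tree are at depth $d/2$, written $\xi=(\xi_{d-1},\dots,\xi_1)$; $\xi|_p$ deletes components with index $<p$; $\bar L(T)=L(T)\cup\{\top\}$, $\top$ maximal, $\top|_p=\top$. For $\nu:V\to\bar L(T)$ (labelings ordered pointwise): arc $vw$ non-violated if ($\pi(v)$ even and $\nu(v)|_{\pi(v)}\ge\nu(w)|_{\pi(v)}$) or ($\pi(v)$ odd and ($\nu(v)|_{\pi(v)}>\nu(w)|_{\pi(v)}$ or $\nu(v)=\nu(w)=\top$)); violated otherwise; tight if $\nu(v)$ is the smallest element of $\bar L(T)$ making $vw$ non-violated when substituted for $\nu(v)$; loose if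 neither. $\nu$ is feasible in a subgraph $K$ if some Even strategy $\sigma$, with $v\sigma(v)\in E(K)$ whenever $v\in V_0$ has an outgoing arc in $K$, makes all arcs of $K$ in $G_\sigma$ non-violated. $\mathrm{drop}(\nu,vw)$ is the largest $\xi\in\bar L(T)$ with $\xi\le\nu(v)$ such that $vw$ is not loose after replacing $\nu(v)$ by $\xi$. Potentials: for each even $p\in[d]$ fix $\Phi_p:V\to\mathbb{Z}_{\ge0}$ with $\Phi_p(v)=0$ iff $\pi(v)>p$; $\Phi_p(v)\ge\Phi_p(w)$ whenever $v$ can reach $w$ in $H_p$; $\Phi_p(v)=\Phi_p(w)>0$ iff $v,w$ are strongly connected in $H_p$. $\Phi^\nu(v):=(\Phi_d(v),\nu(v)_{d-1},\Phi_{d-2}(v),\nu(v)_{d-3},\dots,\Phi_2(v),\nu(v)_1)$ if $\nu(v)\ne\top$ and $\infty$ (larger than all tuples) otherwise, compared lexicographically.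
   Formalization: The leaves of the ordered tree T are assumed to be well-ordered (automatic when T is finite); for infinite T without this, the smallest labels defining ''tight'' and hence drop, and the pointwise minimal labeling, need not exist. *)

(* Defs.v *)
From mathcomp Require Import all_boot all_order.
From mathcomp Require Import boolp classical_sets.

Set Implicit Arguments.
Unset Strict Implicit.
Unset Printing Implicit Defensive.

Import Order.Theory.

(* [option A] is [A] with a new maximal element [None]. *)
Section TopOrder.
Context {disp : Order.disp_t} {A : orderType disp}.

Definition le_top (x y : option A) : bool :=
  match x, y with
  | _, None => true
  | None, Some _ => false
  | Some a, Some b => (a <= b)%O
  end.

Definition lt_top (x y : option A) : bool := (x != y) && le_top x y.

End TopOrder.

(* V0 is the set of nodes of Even; the nodes of Odd are those outside V0. *)
Record parity_game (V : finType) (d : nat) := ParityGame {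
  arc : rel V;
  V0 : {set V};
  prio : V -> nat;
  arc_out : forall v, exists w, arc v w;
  prio_range : forall v, 1 <= prio v <= d
}.

Section Games.
Context {V : finType} {d : nat} (G : parity_game V d).

(* Strategies are total functions; only their values on the nodes of the
   player matter. *)
Definition odd_strategy (tau : V -> V) : Prop :=
  forall v, v \notin V0 G -> arc G v (tau v).

Definition even_strategy (sigma : V -> V) : Prop :=
  forall v, v \in V0 G -> arc G v (sigma v).

Definition arc_odd (tau : V -> V) : rel V :=
  fun v w => if v \in V0 G then arc G v w else w == tau v.

Definition arc_even (sigma : V -> V) : rel V :=
  fun v w => if v \in V0 G then w == sigma v else arc G v w.

Definition is_cycle (E : rel V) (C : seq V) : bool :=
  [&& C != [::], cycle E C & uniq C].

Definition max_prio (C : seq V) : nat := \max_(v <- C) prio G v.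

Definition base (tau : V -> V) : {set V} :=
  finset (fun v : V => `[< exists C : seq V,
    [/\ is_cycle (arc_odd tau) C, ~~ odd (max_prio C),
        v \in C & prio G v = max_prio C] >]).

Definition arc_H (tau : V -> V) : rel V :=
  fun v w => arc_odd tau v w && (v \notin base tau).

(* Reachability in the subgraph of K induced by the nodes of priority <= p. *)
Definition reach_upto (K : rel V) (p : nat) : rel V :=
  fun v w => [&& prio G v <= p, prio G w <= p &
    connect [rel x y | [&& K x y, prio G x <= p & prio G y <= p]] v w].

Definition potential (K : rel V) (Phi : nat -> V -> nat) : Prop :=
  forall p, ~~ odd p -> 1 <= p <= d ->
  [/\ forall v, Phi p v = 0 <-> p < prio G v,
      forall v w, reach_upto K p v w -> Phi p w <= Phi p v
    & forall v w, (Phi p v = Phi p w /\ 0 < Phi p v) <->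
                  (reach_upto K p v w /\ reach_upto K p w v)].

End Games.

Section Trees.
Context {disp : Order.disp_t} {M : orderType disp}.

Definition leaf (T : seqlexi M -> Prop) (s : seqlexi M) : Prop :=
  T s /\ forall t, T t -> prefix s t -> t = s.

Definition ordered_tree (h : nat) (T : seqlexi M -> Prop) : Prop :=
  [/\ T [::],
      forall s t, prefix s t -> T t -> T s,
      forall s, T s -> size s <= h
    & forall s, leaf T s -> size s = h].

(* Holds for every finite tree, see [finite_well_ordered]; for infinite trees
   it guarantees that the smallest elements the notions below refer to exist. *)
Definition well_ordered_leaves (T : seqlexi M -> Prop) : Prop :=
  forall P : seqlexi M -> Prop, (exists2 s, leaf T s & P s) ->
  exists s, [/\ leaf T s, P s &
    forall t, leaf T t -> P t -> (s <= t)%O].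

Lemma finite_well_ordered (T : seqlexi M -> Prop) (e : seq (seqlexi M)) :
  (forall s, T s -> s \in e) -> well_ordered_leaves T.
Proof.
move=> Te P [s0 Ls0 Ps0].
suff: forall n (s : seqlexi M), leaf T s -> P s ->
    count (fun t => (t < s)%O) e <= n ->
    exists s', [/\ leaf T s', P s' &
      forall t, leaf T t -> P t -> (s' <= t)%O].
  by move=> /(_ _ s0 Ls0 Ps0 (leqnn _)).
elim=> [|n IHn] s Ls Ps cs.
  exists s; split=> // t Lt Pt; rewrite leNgt; apply/negP => ts.
  move: cs; rewrite leqn0; apply/negP; rewrite -lt0n -has_count.
  by apply/hasP; exists t => //; apply: Te; case: Lt.
case: (EM (exists t, [/\ leaf T t, P t & (t < s)%O])) => [[t [Lt Pt ts]]|no].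
  apply: (IHn t Lt Pt); rewrite -ltnS; apply: leq_trans cs.
  have te : t \in e by apply: Te; case: Lt.
  elim: e te {Te IHn} => //= a e IHe; rewrite inE => /orP[/eqP<-|/IHe {}IHe].
    rewrite ltxx ts add0n add1n ltnS; apply: sub_count => x xt.
    exact: lt_trans xt ts.
  rewrite -addnS leq_add //.
  by case: (boolP (a < t)%O) => // at_; rewrite (lt_trans at_ ts).
exists s; split=> // t Lt Pt; rewrite leNgt; apply/negP => ts.
by apply: no; exists t.
Qed.

Definition leaf_top (T : seqlexi M -> Prop) (x : option (seqlexi M)) : Prop :=
  if x is Some s then leaf T s else True.

(* [:: d; d - 2; ...; 2] *)
Definition even_prios (d : nat) : seq nat := [seq d - i.*2 | i <- iota 0 d./2].

(* A leaf is written (xi_{d-1}, xi_{d-3}, ..., xi_1): its entries are indexed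
   by the odd numbers k - 1, for k in even_prios. *)
Definition trunc (d p : nat) (x : option (seqlexi M)) : option (seqlexi M) :=
  omap (fun s => mask [seq p <= k.-1 | k <- even_prios d] s : seqlexi M) x.

End Trees.

Section Labelings.
Context {V : finType} {d : nat} (G : parity_game V d).
Context {disp : Order.disp_t} {M : orderType disp} (T : seqlexi M -> Prop).

Notation label := (option (seqlexi M)).

Definition labeling (nu : V -> label) : Prop := forall v, leaf_top T (nu v).

Definition nonviolated (nu : V -> label) (v w : V) : bool :=
  let p := prio G v in
  if odd p then
    lt_top (trunc d p (nu w)) (trunc d p (nu v)) ||
    ((nu v == None) && (nu w == None))
  else le_top (trunc d p (nu w)) (trunc d p (nu v)).

Definition subst (nu : V -> label) (v : V) (x : label) : V -> label :=
  fun u => if u == v then x else nu u.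

Definition tight (nu : V -> label) (v w : V) : Prop :=
  nonviolated nu v w /\
  forall x, leaf_top T x -> nonviolated (subst nu v x) v w -> le_top (nu v) x.

Definition loose (nu : V -> label) (v w : V) : Prop :=
  nonviolated nu v w /\ ~ tight nu v w.

Definition is_drop (nu : V -> label) (v w : V) (x : label) : Prop :=
  let ok y :=
    [/\ leaf_top T y, le_top y (nu v) & ~ loose (subst nu v y) v w] in
  ok x /\ forall y, ok y -> le_top y x.

(* The default value nu v is irrelevant when a largest element exists. *)
Definition drop (nu : V -> label) (v w : V) : label :=
  xget (nu v) (is_drop nu v w).

Definition feasible (K : rel V) (nu : V -> label) : Prop :=
  exists sigma : V -> V,
    [/\ even_strategy G sigma,
        forall v, v \in V0 G -> (exists w, K v w) -> K v (sigma v)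
      & forall v w, K v w -> arc_even G sigma v w -> nonviolated nu v w].

(* The entries (Phi_k(v), nu(v)_{k-1}), for k = d, d - 2, ..., 2, are grouped
   in pairs; lexicographic comparison of pairs and then of sequences is the
   lexicographic comparison of the flattened tuple. *)
Definition key (Phi : nat -> V -> nat) (nu : V -> label) (v : V) :
    option (seqlexi (nat *l M)) :=
  omap (fun s : seqlexi M =>
    zip [seq Phi k v | k <- even_prios d] s : seqlexi (nat *l M)) (nu v).

Variables (tau : V -> V) (Phi : nat -> V -> nat).

(* nu(v) := drop(nu, vw), for the arcs vw of e in the order of e *)
Definition relax (nu : V -> label) (e : seq (V * V)) : V -> label :=
  foldl (fun mu a => subst mu a.1 (drop mu a.1 a.2)) nu e.

Definition arcs_into (S A : {set V}) : {set V * V} :=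
  finset (fun a : V * V =>
    [&& arc_odd G tau a.1 a.2, a.2 \in A & a.1 \notin S]).

(* The while loop, as a relation between its state and the returned labeling:
   the choice among the minimizers u, and the order e in which the arcs are
   processed, are arbitrary. *)
Inductive dijkstra_loop : {set V} -> (V -> label) -> (V -> label) -> Prop :=
| loop_done nu : dijkstra_loop [set: V]%SET nu nu
| loop_step (S : {set V}) (nu : V -> label) (u : V) (e : seq (V * V))
    (nu' : V -> label) :
    u \notin S ->
    (forall v, v \notin S -> le_top (key Phi nu u) (key Phi nu v)) ->
    perm_eq e (enum (arcs_into (u |: S)%SET [set u]%SET)) ->
    dijkstra_loop (u |: S)%SET (relax nu e) nu' ->
    dijkstra_loop S nu nu'.

Definition dijkstra (nu nu' : V -> label) : Prop :=
  let B := base G tau in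
  exists2 e : seq (V * V), perm_eq e (enum (arcs_into B B)) &
    dijkstra_loop B (relax (fun v => if v \in B then nu v else None) e) nu'.

Definition feasible_ext (nu nu' : V -> label) : Prop :=
  [/\ labeling nu', feasible (arc_H G tau) nu'
    & forall v, v \in base G tau -> nu' v = nu v].

Definition least_feasible_ext (nu nu' : V -> label) : Prop :=
  feasible_ext nu nu' /\
  forall mu, feasible_ext nu mu -> forall v, le_top (nu' v) (mu v).

End Labelings.

(* Main.v *)
Require Import Defs.
From mathcomp Require Import boolp classical_sets.
From mathcomp Require Import all_boot all_order.

(* Along an arc of H that is non-violated for a labeling mu with mu(v) <> top,
   the key Phi^mu strictly decreases: the entries of index at least the priority
   of v cannot increase, and equality up to there would need an even priority p
   of v and v, w strongly connected in H_p, making v a base node. Now let S be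
   the set of finished nodes, u the node picked next, and suppose
   mu(u) < nu(u) for a feasible mu. Take x outside S minimizing Phi^mu; its
   non-violated successor must lie in S, so relaxation gave nu(x) <= mu(x), and
   Phi^nu(x) <= Phi^mu(x) <= Phi^mu(u) < Phi^nu(u) contradicts the choice of u. *)

Set Implicit Arguments.
Unset Strict Implicit.
Unset Printing Implicit Defensive.

Import Order.Theory.

(** * The total order with an added top *)

Section LeTop.
Context {disp : Order.disp_t} {A : orderType disp}.
Implicit Types x y z : option A.

Lemma le_top_refl : reflexive (@le_top _ A).
Proof. by case=> /=. Qed.

Lemma le_top_trans : transitive (@le_top _ A).
Proof. by case=> [b|] [a|] [c|] //=; apply: le_trans. Qed.

Lemma le_top_total : total (@le_top _ A).
Proof. by case=> [a|] [b|] //=; apply: le_total. Qed.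

Lemma le_top_anti x y : le_top x y -> le_top y x -> x = y.
Proof.
by case: x y => [a|] [b|] //= ab ba; congr Some; apply: le_anti; rewrite ab.
Qed.

Lemma lt_topNge x y : lt_top x y = ~~ le_top y x.
Proof.
apply/andP/idP => [[/eqP nxy xy]|nyx].
  by apply/negP => yx; apply: nxy; apply: le_top_anti.
split; first by apply: contraNneq nyx => ->; rewrite le_top_refl.
by case/orP: (le_top_total x y) nyx => [//|->].
Qed.

Lemma lt_le_top_trans x y z : lt_top x y -> le_top y z -> lt_top x z.
Proof.
rewrite !lt_topNge => nyx yz; apply: contraNN nyx => zx.
exact: le_top_trans yz zx.
Qed.

Lemma le_lt_top_trans x y z : le_top x y -> lt_top y z -> lt_top x z.
Proof.
rewrite !lt_topNge => xy nzy; apply: contraNN nzy => zx.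
exact: le_top_trans zx xy.
Qed.

Lemma arg_min_le_top (I : finType) (P : pred I) (f : I -> option A) (i0 : I) :
  P i0 -> exists2 i, P i & forall j, P j -> le_top (f i) (f j).
Proof.
move=> Pi0.
by case: (extremumP f le_top_refl le_top_trans le_top_total Pi0) => i; exists i.
Qed.

End LeTop.

(** * The even priorities as indices *)

Lemma sorted_even_prios d : sorted gtn (even_prios d).
Proof.
rewrite sorted_map.
(* Natural subtraction stops at 0, so strict decrease needs [i.*2 < d]; the range of the index is
   therefore carried along. *)
have iota_lt : all [pred i | i < d./2] (iota 0 d./2).
  by apply/allP => i; rewrite mem_iota.
apply: (sub_in_sorted _ iota_lt (iota_ltn_sorted 0 d./2)) => i j _ /= jd ij.
apply: ltn_sub2l; last by rewrite ltn_double.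
apply: (@leq_trans d./2.*2); last by rewrite halfK leq_subr.
by rewrite ltn_double (ltn_trans ij).
Qed.

Lemma size_even_prios d : size (even_prios d) = d./2.
Proof. by rewrite size_map size_iota. Qed.

Lemma mem_even_prios d p : ~~ odd d ->
  (p \in even_prios d) = ~~ odd p && (1 <= p <= d).
Proof.
move=> d_even; apply/mapP/idP => [[i]|/and3P[p_even p_gt0 pd]].
  rewrite mem_iota add0n => /= id ->.
  have idd : i.*2 < d by rewrite -(even_halfK d_even) ltn_double.
  by rewrite oddB ?(ltnW idd) // odd_double addbF d_even subn_gt0 idd leq_subr.
(* Solves [d - i.*2 = p] for [i], both numbers being even. *)
exists (d./2 - p./2).
  rewrite mem_iota add0n /= ltn_subrL !half_gt0.
  have p_gt1 : 1 < p by case: p p_even p_gt0 {pd} => [|[|]].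
  by rewrite p_gt1 (leq_trans p_gt1).
by rewrite doubleB !even_halfK // subKn.
Qed.

(** * Lexicographic comparison under truncation and interleaving *)

Section Lexi.
Context {disp : Order.disp_t} {M : orderType disp}.
Implicit Types (ks : seq nat) (s t : seqlexi M) (f g : nat -> nat).

(** The indices decrease, so once one falls below the threshold all later ones do. Hence truncation
    keeps an initial segment of a leaf, which is why it is monotone. *)
Lemma path_gtn_leq_pred p k ks : path gtn k ks -> ~~ (p <= k.-1) ->
  [seq p <= j.-1 | j <- ks] = nseq (size ks) false.
Proof.
move=> + npk; elim: ks k npk => //= j ks IHks k npk /andP[jk /IHks ->].
  congr (_ :: _); apply: contraNF npk => /leq_trans; apply.
  by rewrite -!subn1 leq_sub2r // ltnW.
apply: contraNN npk => /leq_trans; apply.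
by rewrite -!subn1 leq_sub2r // ltnW.
Qed.

Lemma mask_lexi p ks s t : sorted gtn ks -> (s <= t)%O ->
  (mask [seq (p <= k.-1)%N | k <- ks] s <=
   mask [seq (p <= k.-1)%N | k <- ks] t :> seqlexi M)%O.
Proof.
elim: ks s t => [|k ks IHks] [|a s] [|b t] //= ks_sorted.
case: ifPn => [_|npk _]; last by rewrite (path_gtn_leq_pred ks_sorted npk) !mask_false.
rewrite !lexi_cons => /andP[-> /implyP st] /=; apply/implyP => /st.
by apply: IHks; apply: path_sorted ks_sorted.
Qed.

Lemma zip_ltxi f ks s t : size s = size ks -> size t = size ks -> (s < t)%O ->
  (zip [seq f k | k <- ks] s <
   zip [seq f k | k <- ks] t :> seqlexi (nat *l M))%O.
Proof.
elim: ks s t => [|k ks IHks] [|a s] [|b t] //= [ss] [st].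
rewrite !ltxi_cons !lexi_pair lexx /= => /andP[-> /implyP lt_st] /=.
by apply/implyP => /lt_st; apply: IHks.
Qed.

(** On the kept positions both components weakly increase. Either some kept entry decides strictly,
    or the first dropped position is that of [p] itself, whose pair starts with [f p < g p]. The
    label entries dropped with it come after this comparison. *)
Lemma zip_mask_ltxi p f g ks s t :
    sorted gtn ks -> size s = size ks -> size t = size ks ->
    (forall k, k \in ks -> p <= k -> f k <= g k) ->
    let m := [seq (p <= k.-1)%N | k <- ks] in
    (mask m s < mask m t :> seqlexi M)%O \/
      [/\ p \in ks, 0 < p, f p < g p & (mask m s <= mask m t :> seqlexi M)%O] ->
  (zip [seq f k | k <- ks] s <
   zip [seq g k | k <- ks] t :> seqlexi (nat *l M))%O.
Proof.
elim: ks s t => [|k ks IHks] [|a s] [|b t] //=; try by move=> _ _ _ _ [|[]].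
move=> ks_sorted [ss] [st] fg.
have fg' k' : k' \in ks -> p <= k' -> f k' <= g k'.
  by move=> k'ks; apply: fg; rewrite inE k'ks orbT.
have {}IHks := IHks s t (path_sorted ks_sorted) ss st fg'.
case: ifPn => [pk|npk] mst; rewrite ltxi_cons !lexi_pair !leEnat.
  have := fg k (mem_head _ _) (leq_trans pk (leq_pred _)).
  case: (ltngtP (f k) (g k)) => //= _ _.
  rewrite !ltxi_cons !lexi_cons in mst.
  have ab : (a <= b)%O by case: mst => [|[_ _ _]] /andP[].
  rewrite ab /=; apply/implyP => ba; apply: IHks.
  rewrite ab ba /= in mst.
  case: mst => [|[pks p0 fgp mst]]; [by left|right; split=> //].
  (* The head is kept, so [p <= k.-1]; as [p] is positive this excludes [p = k]. *)
  move: pks; rewrite inE => /orP[/eqP pk'|//].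
  by move: pk; rewrite -pk' -ltnS prednK ?ltnn.
(* The head is dropped, so both masks are empty and the strict alternative fails; then [p] can only
   be the head index. *)
rewrite (path_gtn_leq_pred ks_sorted npk) !mask_false ltxx in mst.
case: mst => [//|[+ p_gt0 fgp _]]; rewrite inE => /predU1P[pk|pks].
  by rewrite -pk (ltnW fgp) leqNgt fgp.
have trans_gtn : transitive gtn by move=> y x z xy yz; apply: ltn_trans yz xy.
have pk : p < k by apply: (allP (order_path_min trans_gtn ks_sorted)).
by case/negP: npk; rewrite -ltnS (ltn_predK pk).
Qed.

End Lexi.

(** * Base nodes and feasibility in the game graph *)

Section Games.
Context {V : finType} {d : nat} (G : parity_game V d) (tau : V -> V).
Hypothesis tau_odd : odd_strategy G tau.
Local Notation B := (base G tau).
Local Notation H := (arc_H G tau).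

(** A path from [w] back to [v] through priorities at most that of [v], made simple and closed by
    the arc [vw], is an even cycle of maximal priority at [v]. Then [v] would be a base node, and
    base nodes have no outgoing arc in [H]. *)
Lemma arc_odd_prio_base v w : arc_H G tau v w -> ~~ odd (prio G v) ->
  ~~ reach_upto G H (prio G v) w v.
Proof.
case/andP=> vw nvB v_even; apply: contraNN nvB => /and3P[wv _ /connectP[c]].
case/shortenP=> {}c c_path c_uniq _ v_last.
rewrite inE; apply/asboolP; exists (w :: c).
have c_prio x : x \in w :: c -> prio G x <= prio G v.
  rewrite inE => /predU1P[->//|]; move: c_path {vw wv v_last c_uniq}.
  elim: c w => //= y c IHc w /andP[/and3P[_ _ yv] /IHc{}IHc].
  by rewrite inE => /predU1P[->|/IHc].
have vc : v \in w :: c by rewrite v_last mem_last.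
have c_max : prio G v = max_prio G (w :: c).
  apply/eqP; rewrite eqn_leq leq_bigmax_seq //=.
  by apply/bigmax_leqP_seq => x xc _; apply: c_prio.
split; rewrite -?c_max //.
apply/and3P; split=> //; rewrite /= rcons_path -v_last vw andbT.
by apply: sub_path c_path => x y /and3P[/andP[]].
Qed.

(** This removes the strategy from feasibility. At an Even node the strategy selects the witness; at
    an Odd node [tau] leaves a single arc, so one non-violated arc is the same as all of them. *)
Lemma feasibleP {disp : Order.disp_t} {M : orderType disp}
    (nu : V -> option (seqlexi M)) :
  feasible G H nu <->
  forall v, v \notin B -> exists2 w, arc_odd G tau v w & nonviolated G nu v w.
Proof.
split=> [[sigma [sigmaV0 sigmaH nuH]] v vB|nuB].
  have [vV0|vV0] := boolP (v \in V0 G).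
    have vs : H v (sigma v).
      apply: sigmaH => //; have [w vw] := arc_out G v.
      by exists w; rewrite /arc_H /arc_odd vV0 vw.
    exists (sigma v); first by case/andP: vs.
    by apply: nuH => //; rewrite /arc_even vV0.
  have vt : arc_odd G tau v (tau v) by rewrite /arc_odd (negPf vV0).
  exists (tau v) => //; apply: nuH; first by rewrite /arc_H vt.
  by rewrite /arc_even (negPf vV0); apply: tau_odd.
(* The default keeps [sigma] a legal strategy at base nodes, where no non-violated arc is
   guaranteed. *)
pose sigma v := odflt (xchoose (arc_out G v))
  [pick w | arc_odd G tau v w && nonviolated G nu v w].
have sigmaV0 v : v \in V0 G -> arc_odd G tau v (sigma v).
  rewrite /sigma => vV0; case: pickP => [w /andP[]//|_] /=.
  by rewrite /arc_odd vV0; apply: xchooseP.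
exists sigma; split=> [v vV0|v vV0 [w /andP[_ vB]]|v w /andP[vw vB]].
- by have := sigmaV0 v vV0; rewrite /arc_odd vV0.
- by rewrite /arc_H vB sigmaV0.
have [u vu nuu] := nuB v vB.
rewrite /arc_even; case: ifPn => [vV0 /eqP->|vV0 _].
  rewrite /sigma; case: pickP => [x /andP[]//|/(_ u)].
  by rewrite vu nuu.
by move: vu vw; rewrite /arc_odd (negPf vV0) => /eqP vu /eqP ->; rewrite -vu.
Qed.

End Games.

(** * Non-violation as a relation between labels *)

Section Labels.
Context {disp : Order.disp_t} {M : orderType disp}.
Implicit Types (a b x y : option (seqlexi M)) (s t : seqlexi M).

(** Depends on label values only, so that monotonicity in each of them can be stated;
    [nonviolated G nu v w] is convertible to [admits d (prio G v) (nu v) (nu w)]. *)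
Definition admits d p a b : bool :=
  if odd p then
    lt_top (trunc d p b) (trunc d p a) || ((a == None) && (b == None))
  else le_top (trunc d p b) (trunc d p a).

Lemma le_trunc d p x y : le_top x y -> le_top (trunc d p x) (trunc d p y).
Proof.
case: x y => [s|] [t|] //= st; apply: mask_lexi => //.
exact: sorted_even_prios.
Qed.

Lemma admits_top d p b : admits d p None b.
Proof. by rewrite /admits /=; case: b => [b|]; case: odd. Qed.

Lemma admitsWl d p a a' b : le_top a a' -> admits d p a b -> admits d p a' b.
Proof.
move=> aa'; have ta := le_trunc d p aa'; rewrite /admits; case: odd => [|ba].
  case/orP=> [ba|/andP[/eqP a0 ->]]; first by rewrite (lt_le_top_trans ba ta).
  by case: a' aa' {ta} => [a'|]; rewrite a0 // orbT.
exact: le_top_trans ba ta.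
Qed.

Lemma admitsWr d p a b b' : le_top b' b -> admits d p a b -> admits d p a b'.
Proof.
case: a => [s|]; last by rewrite !admits_top.
move=> bb'; have tb := le_trunc d p bb'; rewrite /admits !orbF; case: odd.
  exact: le_lt_top_trans tb.
exact: le_top_trans tb.
Qed.

Lemma admits_Some d p s b : admits d p (Some s) b -> exists t, b = Some t.
Proof. by case: b => [t|]; [exists t|rewrite /admits /=; case: odd]. Qed.

Variable T : seqlexi M -> Prop.
Hypothesis T_wo : well_ordered_leaves T.

(** Well-ordering of the leaves enters here; if no leaf satisfies [P], the top is the least
    element. *)
Lemma least_leaf_top (P : option (seqlexi M) -> Prop) : P None ->
  exists x, [/\ leaf_top T x, P x & forall y, leaf_top T y -> P y -> le_top x y].
Proof.
move=> P0; have [[s Ls Ps]|noP] := EM (exists2 s, leaf T s & P (Some s)).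
  have [|t [Lt Pt t_min]] := T_wo (P := P \o Some); first by exists s.
  by exists (Some t); split=> // -[y|] //=; apply: t_min.
by exists None; split=> // -[y|] //= Ly Py; case: noP; exists y.
Qed.

End Labels.

(** * The drop operation and sequences of relaxations *)

Section Drop.
Context {V : finType} {d : nat} (G : parity_game V d).
Context {disp : Order.disp_t} {M : orderType disp} (T : seqlexi M -> Prop).
Hypothesis T_wo : well_ordered_leaves T.
Implicit Types (nu : V -> option (seqlexi M)) (S : {set V}).
Local Notation admits := (admits d).

(** Admissible labels are closed upwards. So a label that leaves the arc violated lies below all
    admissible ones, and one that makes it tight is the least of them. The condition [w != v]
    protects the label of [w] from the substitution. *)
Lemma loose_substP nu v w y : w != v -> leaf_top T y ->
  ~ loose G T (subst nu v y) v w <->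
  forall z, leaf_top T z -> admits (prio G v) z (nu w) -> le_top y z.
Proof.
move=> wv Ly.
have E z : nonviolated G (subst (subst nu v y) v z) v w = admits (prio G v) z (nu w).
  by rewrite /nonviolated /subst eqxx (negPf wv).
have E' : nonviolated G (subst nu v y) v w = admits (prio G v) y (nu w).
  by rewrite /nonviolated /subst eqxx (negPf wv).
split=> [nloose_y z Lz zw|y_min [yw []]]; last first.
  by split=> // z Lz; rewrite E {1}/subst eqxx; apply: y_min.
have [yw|nyw] := boolP (admits (prio G v) y (nu w)).
  have : tight G T (subst nu v y) v w.
    by apply: contrapT => ntight_y; apply: nloose_y; split; rewrite ?E'.
  by case=> _ /(_ z Lz); rewrite E {1}/subst eqxx; apply.
have [//|zy] := orP (le_top_total y z).
by case/negP: nyw; apply: admitsWl zy zw.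
Qed.

(** The candidates in [drop] are the labels below both [nu v] and the least admissible label [l].
    Their maximum is the smaller of these two, so the default of [xget] is never returned. *)
Lemma drop_spec nu v w : w != v -> leaf_top T (nu v) ->
  let x := Defs.drop G T nu v w in
  [/\ leaf_top T x, le_top x (nu v),
      x = nu v \/ admits (prio G v) x (nu w)
    & forall y, leaf_top T y -> admits (prio G v) y (nu w) -> le_top x y].
Proof.
move=> wv Lv.
have [l [Ll lw l_min]] := least_leaf_top T_wo
  (P := fun a => admits (prio G v) a (nu w)) (admits_top _ _ _).
pose m := if le_top l (nu v) then l else nu v.
have [Lm mv ml] : [/\ leaf_top T m, le_top m (nu v) & le_top m l].
  rewrite /m; case: ifPn => [|nlv]; first by rewrite le_top_refl.
  by case/orP: (le_top_total l (nu v)) nlv => [->//|]; rewrite le_top_refl.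
have m_drop : is_drop G T nu v w m.
  split=> [|y [Ly yv /(loose_substP _ wv Ly) y_min]].
    split=> //; apply/(loose_substP _ wv Lm) => z Lz /(l_min z Lz).
    exact: le_top_trans.
  by rewrite /m; case: ifP => // _; apply: y_min.
rewrite /= /Defs.drop.
have [x_ok x_max] := xgetPex (nu v) (ex_intro _ m m_drop).
have [Lx xv /(loose_substP _ wv Lx) x_min] := x_ok.
split=> //.
have xm : xget (nu v) (is_drop G T nu v w) = m.
  have [m_ok m_max] := m_drop.
  by apply: le_top_anti; [apply: m_max|apply: x_max].
by rewrite xm /m; case: ifP => _; [right|left].
Qed.

(** All arcs lead from outside [S] into [S], so the head labels stay fixed during the sweep. Hence
    every bound can be stated with the initial [nu w], whatever the order of the arcs. *)
Lemma relax_spec S nu (e : seq (V * V)) : labeling T nu ->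
    (forall a, a \in e -> a.1 \notin S /\ a.2 \in S) ->
  let nu' := relax G T nu e in
  [/\ labeling T nu', forall w, w \in S -> nu' w = nu w,
      forall v, le_top (nu' v) (nu v),
      forall v, nu' v = nu v \/
        exists2 w, (v, w) \in e & admits (prio G v) (nu' v) (nu w)
    & forall v w, (v, w) \in e -> forall y, leaf_top T y ->
        admits (prio G v) y (nu w) -> le_top (nu' v) y].
Proof.
rewrite /relax; elim: e nu => [|[v w] e IHe] nu nu_lab eS /=.
  by split=> // v; [apply: le_top_refl|left].
have [vS wS] : v \notin S /\ w \in S by apply: (eS (v, w)); rewrite mem_head.
have wv : w != v by apply: contraNneq vS => <-.
have [Lx xv x_nu x_min] := drop_spec wv (nu_lab v).
set x := Defs.drop G T nu v w in Lx xv x_nu x_min *.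
have mu_lab : labeling T (subst nu v x) by move=> u; rewrite /subst; case: ifP.
have muS u : u \in S -> subst nu v x u = nu u.
  by move=> uS; rewrite /subst; case: eqP => // uv; rewrite -uv uS in vS.
have [|lab' S' le' nu'E min'] := IHe _ mu_lab.
  by move=> a ae; apply: eS; rewrite inE ae orbT.
set nu' := foldl _ _ e in lab' S' le' nu'E min' *.
have eS2 u z : (u, z) \in e -> z \in S.
  by move=> uz; have [] := eS (u, z); rewrite // inE uz orbT.
split=> // [u uS|u|u|u z].
- by rewrite S' // muS.
- apply: le_top_trans (le' u) _; rewrite /subst; case: eqP => [->//|_].
  exact: le_top_refl.
- have [->|[z uz]] := nu'E u; last first.
    by rewrite muS ?(eS2 u z) // => uz'; right; exists z; rewrite // inE uz orbT.
  rewrite /subst; case: eqP => [->|_]; last by left.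
  by case: x_nu => [|xw]; [left|right; exists w; rewrite // mem_head].
rewrite inE => /predU1P[[-> ->] y Ly yw|uz y Ly].
  by apply: le_top_trans (le' v) _; rewrite /subst eqxx; apply: x_min.
by rewrite -muS ?(eS2 u z) //; apply: min'.
Qed.

End Drop.

(** * Decrease of the key along arcs of [H] *)

Section Potential.
Context {V : finType} {d : nat} (G : parity_game V d) (tau : V -> V).
Context {disp : Order.disp_t} {M : orderType disp} (T : seqlexi M -> Prop).
Variable Phi : nat -> V -> nat.
Hypothesis d_even : ~~ odd d.
Hypothesis T_tree : ordered_tree d./2 T.
Hypothesis Phi_pot : potential G (arc_H G tau) Phi.
Implicit Types (mu nu : V -> option (seqlexi M)) (S : {set V}).
Local Notation key := (key (d := d) Phi).
Local Notation H := (arc_H G tau).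

Lemma size_leaf s : leaf T s -> size s = size (even_prios d).
Proof. by rewrite size_even_prios => Ls; case: T_tree => _ _ _; apply. Qed.

(** Both keys belong to the same node and share their potentials, so the labels decide. Leaves have
    full length, so [zip] cuts nothing off. *)
Lemma lt_key mu nu v : leaf_top T (mu v) -> leaf_top T (nu v) ->
  lt_top (mu v) (nu v) -> lt_top (key mu v) (key nu v).
Proof.
rewrite /Defs.key; case: (mu v) (nu v) => [s|] [t|] //= Ls Lt.
rewrite !lt_topNge /= -!ltNge => st.
by apply: zip_ltxi => //; apply: size_leaf.
Qed.

Lemma le_key mu nu v : leaf_top T (mu v) -> leaf_top T (nu v) ->
  le_top (mu v) (nu v) -> le_top (key mu v) (key nu v).
Proof.
move=> Lmu Lnu mn; have [nm|] := boolP (le_top (nu v) (mu v)).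
  by rewrite /Defs.key (le_top_anti mn nm) le_top_refl.
by rewrite -lt_topNge => /(lt_key Lmu Lnu)/andP[].
Qed.

(** Either [w] has priority above [p] and potential 0, or the arc itself is a path in [H_p]. *)
Lemma potential_arc p v w : p \in even_prios d -> H v w -> prio G v <= p ->
  Phi p w <= Phi p v.
Proof.
rewrite mem_even_prios // => /andP[p_even p_range] vw vp.
have [Phi0 Phi_reach _] := Phi_pot p_even p_range.
have [wp|pw] := leqP (prio G w) p; last by rewrite (Phi0 w).2.
apply: Phi_reach; rewrite /reach_upto vp wp /=; apply: connect1.
by rewrite /= vw vp wp.
Qed.

(** Equality at this positive value would make [v] and [w] strongly connected in [H_p], which
    [arc_odd_prio_base] forbids. *)
Lemma potential_arc_prio v w : ~~ odd (prio G v) -> H v w ->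
  Phi (prio G v) w < Phi (prio G v) v.
Proof.
move=> v_even vw; have v_range := prio_range G v.
have v_mem : prio G v \in even_prios d by rewrite mem_even_prios // v_even.
have [Phi0 _ Phi_scc] := Phi_pot v_even v_range.
rewrite ltn_neqAle (potential_arc v_mem vw) // andbT.
apply: contra (arc_odd_prio_base vw v_even) => /eqP wv.
apply: ((Phi_scc w v).1 _).1; split=> //; rewrite wv lt0n.
by apply/eqP => /(Phi0 v).1; rewrite ltnn.
Qed.

Lemma key_arc mu v w : labeling T mu -> H v w ->
    admits d (prio G v) (mu v) (mu w) -> mu v != None ->
  lt_top (key mu w) (key mu v).
Proof.
move=> mu_lab vw; have := mu_lab v; have := mu_lab w.
rewrite /Defs.key; case: (mu v) => // s Lw Ls mu_vw _.
have [t mu_w] := admits_Some mu_vw; rewrite mu_w /= in Lw mu_vw *.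
rewrite lt_topNge /= -ltNge; apply: (zip_mask_ltxi (p := prio G v)).
- exact: sorted_even_prios.
- exact: size_leaf.
- exact: size_leaf.
- by move=> k k_mem; apply: potential_arc.
(* The parities match the alternatives of [zip_mask_ltxi]: odd priority gives a strict drop of
   truncated labels, even priority a strict drop of the potential at that priority. *)
move: mu_vw; rewrite /admits /=; case: ifPn => [_|v_even st].
  by rewrite orbF lt_topNge /= -ltNge; left.
right; split=> //; last exact: potential_arc_prio.
  by rewrite mem_even_prios // v_even prio_range.
by case/andP: (prio_range G v).
Qed.

End Potential.

(** * The loop invariant and correctness *)

Section Dijkstra.
Context {V : finType} {d : nat} (G : parity_game V d) (tau : V -> V).
Context {disp : Order.disp_t} {M : orderType disp} (T : seqlexi M -> Prop).
Variable Phi : nat -> V -> nat.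
Hypothesis d_even : ~~ odd d.
Hypothesis tau_odd : odd_strategy G tau.
Hypothesis T_tree : ordered_tree d./2 T.
Hypothesis T_wo : well_ordered_leaves T.
Hypothesis Phi_pot : potential G (arc_H G tau) Phi.
Implicit Types (mu nu : V -> option (seqlexi M)) (S : {set V}).
Local Notation key := (key (d := d) Phi).
Local Notation H := (arc_H G tau).
Local Notation B := (base G tau).
Local Notation admits := (admits d).

(** Records only the upper bounds imposed by relaxation; that labels are not lowered too far is the
    task of [inv_admits]. *)
Definition relaxed S nu : Prop :=
  forall v w, v \notin S -> w \in S -> arc_odd G tau v w ->
  forall y, leaf_top T y -> admits (prio G v) y (nu w) -> le_top (nu v) y.

Lemma argmin_le_feasible S nu mu u : B \subset S -> labeling T nu ->
    relaxed S nu ->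
    labeling T mu -> feasible G H mu ->
    (forall w, w \in S -> le_top (nu w) (mu w)) ->
    u \notin S -> (forall v, v \notin S -> le_top (key nu u) (key nu v)) ->
  le_top (nu u) (mu u).
Proof.
move=> BS nu_lab nu_relax mu_lab /(feasibleP tau_odd) mu_feas nu_mu uS u_min.
apply: contraT; rewrite -lt_topNge => lt_u.
have {}lt_u : lt_top (key mu u) (key nu u) by apply: (lt_key (T := T)).
have [x xS x_min] := arg_min_le_top (P := [pred v | v \notin S]) (key mu) uS.
(* The minimality of [x] for [mu] and of [u] for [nu] transport the strict inequality from [u] to
   [x]. *)
have lt_x : lt_top (key mu x) (key nu x).
  by apply: le_lt_top_trans (x_min u uS) (lt_le_top_trans lt_u (u_min x xS)).
have xB : x \notin B by apply: contraNN xS => /(subsetP BS).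
have [w xw mu_xw] := mu_feas x xB.
have [wS|wS] := boolP (w \in S).
  move: lt_x; rewrite lt_topNge => /negP[]; apply: (le_key (T := T)) => //.
  by apply: (nu_relax x w) => //; apply: admitsWr mu_xw; apply: nu_mu.
have := x_min w wS; apply: contraTT => _; rewrite -lt_topNge.
apply: (key_arc (tau := tau) d_even T_tree Phi_pot) => //.
  by rewrite /arc_H xw.
(* With a top label, the key of [mu] at [x] would be maximal and could not lie below another key. *)
by apply: contraTneq lt_x; rewrite lt_topNge /Defs.key => -> ; case: (nu x).
Qed.

(** Once [S] is everything, [inv_admits] yields feasibility and [inv_least] minimality. The field
    [inv_relaxed] serves to extend [inv_least] to the next node. *)
Record invariant nu0 S nu : Prop := Invariant {
  inv_base : B \subset S;
  inv_labeling : labeling T nu;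
  inv_eq_base : forall v, v \in B -> nu v = nu0 v;
  inv_admits : forall v, v \notin B -> nu v = None \/
    exists w, [/\ w \in S, arc_odd G tau v w & admits (prio G v) (nu v) (nu w)];
  inv_relaxed : relaxed S nu;
  inv_least : forall mu, feasible_ext G T tau nu0 mu ->
    forall w, w \in S -> le_top (nu w) (mu w)
}.

Lemma invariant_init nu0 e : labeling T nu0 ->
    perm_eq e (enum (arcs_into G tau B B)) ->
  invariant nu0 B (relax G T (fun v => if v \in B then nu0 v else None) e).
Proof.
move=> nu0_lab e_arcs; set nu := fun v => _.
have eP v w : (v, w) \in e = [&& arc_odd G tau v w, w \in B & v \notin B].
  by rewrite (perm_mem e_arcs) mem_enum inE.
have nu_lab : labeling T nu by move=> v; rewrite /nu; case: ifP.
have [|lab' B' _ nu'E min'] := relax_spec G T_wo (S := B) (e := e) nu_lab.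
  by case=> v w; rewrite eP => /and3P[].
have nuB v : v \in B -> nu v = nu0 v by rewrite /nu => ->.
split=> // [v vB|v vB|v w vB wB vw y Ly|mu [_ _ mu_base] w wB].
- by rewrite B' // nuB.
- have [->|[w]] := nu'E v; first by left; rewrite /nu (negPf vB).
  rewrite eP => /and3P[vw wB _] mu_vw.
  by right; exists w; split=> //; rewrite (B' w).
- by rewrite B' //; apply: min' => //; rewrite eP vw wB.
- by rewrite B' // nuB // mu_base // le_top_refl.
Qed.

(** The sweep alters labels only outside [u |: S], so claims about finished nodes carry over.
    Minimality at [u] is the new content and comes from [argmin_le_feasible]. *)
Lemma invariant_step nu0 S nu u e : invariant nu0 S nu -> u \notin S ->
    (forall v, v \notin S -> le_top (key nu u) (key nu v)) ->
    perm_eq e (enum (arcs_into G tau (u |: S) [set u])) ->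
  invariant nu0 (u |: S) (relax G T nu e).
Proof.
move=> [BS nu_lab nu_base nu_admits nu_relax nu_least] uS u_min e_arcs.
have eP v w : (v, w) \in e = [&& arc_odd G tau v w, w == u & v \notin u |: S].
  by rewrite (perm_mem e_arcs) mem_enum !inE.
have [|lab' S' le' nu'E min'] := relax_spec G T_wo (S := u |: S) (e := e) nu_lab.
  by case=> v w; rewrite eP => /and3P[_ /eqP-> ]; rewrite setU11.
have SuS w : w \in S -> w \in u |: S by move=> wS; rewrite inE wS orbT.
have BuS w : w \in B -> w \in u |: S by move/(subsetP BS)/SuS.
split=> // [|v vB|v vB|v w vS wS vw y Ly|mu mu_ext w wS].
- by apply/subsetP => v; apply: BuS.
- by rewrite S' ?BuS // nu_base.
- have [->|[w]] := nu'E v; last first.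
    rewrite eP => /and3P[vw /eqP wu _]; rewrite wu in vw * => nu_vu.
    by right; exists u; rewrite (S' u) setU11.
  have [->|[w [wS vw nu_vw]]] := nu_admits v vB; first by left.
  by right; exists w; rewrite S' ?SuS.
(* A bound from [u] is produced by this sweep; a bound from an older node persists because labels
   only decrease. *)
- rewrite S' // => yw; have [wu|wu] := eqVneq w u.
    by apply: min' yw => //; rewrite eP vw wu eqxx.
  apply: le_top_trans (le' v) (nu_relax v w _ _ vw y Ly yw).
    by apply: contraNN vS => /SuS.
  by move: wS; rewrite !inE (negPf wu).
- rewrite S' //; move: wS; rewrite in_setU1 => /predU1P[->|]; last exact: nu_least.
  have [mu_lab mu_feas _] := mu_ext.
  by apply: (argmin_le_feasible BS) u_min => // x xS; apply: nu_least.
Qed.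

Lemma invariant_loop nu0 S nu nu' : invariant nu0 S nu ->
  dijkstra_loop G T tau Phi S nu nu' -> invariant nu0 [set: V] nu'.
Proof.
move=> + loop; elim: loop => // {}S {}nu u e {}nu' uS u_min e_arcs _ IH inv.
exact/IH/invariant_step.
Qed.

Lemma invariant_least_feasible_ext nu0 nu : invariant nu0 [set: V] nu ->
  least_feasible_ext G T tau nu0 nu.
Proof.
case=> _ nu_lab nu_base nu_admits _ nu_least; split; last first.
  by move=> mu mu_ext v; apply: nu_least; rewrite ?inE.
split=> //; apply/(feasibleP tau_odd) => v vB.
(* At a top label any outgoing arc is non-violated, so some arc of [G_tau] suffices. *)
have [nu_v|[w [_ vw nu_vw]]] := nu_admits v vB; last by exists w.
have [w vw] : exists w, arc_odd G tau v w.
  have [vV0|vV0] := boolP (v \in V0 G).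
    by have [w vw] := arc_out G v; exists w; rewrite /arc_odd vV0.
  by exists (tau v); rewrite /arc_odd (negPf vV0).
by exists w => //; rewrite -[nonviolated G nu v w]/(admits _ (nu v) (nu w)) nu_v admits_top.
Qed.

(** The loop is a relation, so the existence of a run is a separate claim. A minimizer exists while
    [S] is not everything, and each round shrinks the complement of [S]. *)
Lemma dijkstra_loop_total S nu : exists nu', dijkstra_loop G T tau Phi S nu nu'.
Proof.
have [n] := ubnP #|~: S|; elim: n S nu => // n IHn S nu.
have [/setP ST _|[u]] := set_0Vmem (~: S).
  have -> : S = [set: V].
    by apply/setP => v; have := ST v; rewrite !inE => /negbFE.
  by exists nu; constructor.
rewrite inE => uS Sn.
have [{}u /= {}uS u_min] := arg_min_le_top (P := [pred v | v \notin S]) (key nu) uS.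
have [|nu' loop] := IHn (u |: S) (relax G T nu (enum (arcs_into G tau (u |: S) [set u]))).
  rewrite -ltnS; apply: leq_trans Sn; rewrite ltnS; apply: proper_card; rewrite setCU.
  by rewrite properEneq subsetIr andbT; apply/eqP => /setP/(_ u); rewrite !inE eqxx uS.
by exists nu'; apply: (loop_step uS u_min (perm_refl _) loop).
Qed.

End Dijkstra.

Theorem theorem5p3 (V : finType) (d : nat) (G : parity_game V d)
    (tau : V -> V) (disp : Order.disp_t) (M : orderType disp)
    (T : seqlexi M -> Prop) (Phi : nat -> V -> nat)
    (d_even : ~~ odd d)
    (tau_odd : odd_strategy G tau)
    (T_tree : ordered_tree d./2 T)
    (T_wo : well_ordered_leaves T)
    (Phi_pot : potential G (arc_H G tau) Phi)
    (nu : V -> option (seqlexi M)) (nu_lab : labeling T nu) :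
  (exists nu', dijkstra G T tau Phi nu nu') /\
  (forall nu', dijkstra G T tau Phi nu nu' ->
     least_feasible_ext G T tau nu nu').
Proof.
split=> [|nu' [e e_arcs loop]].
  have [nu' loop] := dijkstra_loop_total G tau T Phi (base G tau)
    (relax G T (fun v => if v \in base G tau then nu v else None)
       (enum (arcs_into G tau (base G tau) (base G tau)))).
  by exists nu'; exists (enum (arcs_into G tau (base G tau) (base G tau))).
apply: (invariant_least_feasible_ext tau_odd).
by apply: (invariant_loop d_even tau_odd T_tree T_wo Phi_pot) loop; apply: invariant_init.
Qed.
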